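(* Let $a<b$ be real numbers and let $g:\mathbb{R}\to\mathbb{R}$ be non-decreasing and left continuous. Then $\mathbb{F}[g]$ (with its elements restricted to $[a,b]$) is dense in $\operatorname{BUC}_g([a,b],\mathbb{F})$ with respect to the supremum norm.
   Context: $\mathbb{F}$ is $\mathbb{R}$ or $\mathbb{C}$. $\mathbb{F}[g]$ is the set of all functions of the form $\sum_{k=0}^n a_k g^k$ with $n\in\mathbb{N}$ and $a_0,\dots,a_n\in\mathbb{F}$, where $g^k$ denotes the pointwise $k$-th power of $g$. A function $f:[a,b]\to\mathbb{F}$ is uniformly $g$-continuous if for every $\varepsilon>0$ there is $\delta>0$ such that $|f(t)-f(s)|<\varepsilon$ for all $s,t\in[a,b]$ with $|g(t)-g(s)|<\delta$. $\operatorname{BUC}_g([a,b],\mathbb{F})$ is the space of bounded uniformly $g$-continuous functions $[a,b]\to\mathbb{F}$ with the supremum norm. *)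

(* Defs.v *)
From HB Require Import structures.
From mathcomp Require Import all_boot all_order all_algebra.
From mathcomp Require Import all_classical all_reals all_analysis.
From mathcomp.real_closed Require Export complex.

Set Implicit Arguments.
Unset Strict Implicit.
Unset Printing Implicit Defensive.

Import Order.TTheory GRing.Theory Num.Theory.
Import numFieldNormedType.Exports.

Local Open Scope classical_set_scope.
Local Open Scope ring_scope.

(* [Rcomplex R] is [R[i]] with the field structure of the complex numbers and
   with the modulus as an [R]-valued norm. The library only makes it a normed
   Z-module; the topology below is the one defined by the modulus. *)
Section Rcomplex_normedModType.
Context {R : realType}.

Let Rcomplex_normrZ (k : R) (z : Rcomplex R) : `|k *: z| = `|k| * `|z|.
Proof.
case: z => x y; rewrite -sqrtr_sqr.
transitivity (Num.sqrt ((k * x) ^+ 2 + (k * y) ^+ 2)); first by [].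
transitivity (Num.sqrt (k ^+ 2) * Num.sqrt (x ^+ 2 + y ^+ 2)); last by [].
by rewrite -sqrtrM ?sqr_ge0// !exprMn mulrDr.
Qed.

HB.instance Definition _ :=
  PseudoMetric.copy (Rcomplex R) (pseudoMetric_normed (Rcomplex R)).
HB.instance Definition _ := isPointed.Build (Rcomplex R) 0.
HB.instance Definition _ :=
  NormedZmod_PseudoMetric_eq.Build R (Rcomplex R) erefl.
HB.instance Definition _ :=
  PseudoMetricNormedZmod_Lmodule_isNormedModule.Build R (Rcomplex R)
    Rcomplex_normrZ.

End Rcomplex_normedModType.

Definition left_continuous (R : realType) (g : R -> R) :=
  forall x, g y @[y --> x^'-] --> g x.

Definition segment (R : realType) (a b : R) := {t : R | t \in `[a, b]}.

Definition restrict_segment (R : realType) (T : Type) (a b : R) (h : R -> T) :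
  segment a b -> T := fun t => h (val t).

Arguments restrict_segment {R T} a b h.

Definition uniformly_g_continuous (R : realType) (V : normedModType R)
    (g : R -> R) (a b : R) (f : segment a b -> V) :=
  forall eps : R, 0 < eps -> exists2 delta : R, 0 < delta &
    forall s t : segment a b,
      `|g (val t) - g (val s)| < delta -> `|f t - f s| < eps.

(* [iota] is the embedding of the reals into the field of coefficients. *)
Definition g_polynomials (R : realType) (F : nzRingType) (iota : R -> F)
    (g : R -> R) : set (R -> F) :=
  [set h | exists (n : nat) (c : 'I_n.+1 -> F),
    h = fun t => \sum_(k < n.+1) c k * iota (g t) ^+ k].

Section BUC.
Context {R : realType} (V : normedModType R) (g : R -> R) (a b : R).
Implicit Types f h : segment a b -> V.

Definition BUC_pred : {pred (segment a b -> V)} :=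
  fun f => `[< bounded_fun f /\ uniformly_g_continuous g f >].

Record BUC := mkBUC { BUC_fun :> segment a b -> V ; _ : BUC_fun \in BUC_pred }.

HB.instance Definition _ := [isSub for BUC_fun].
HB.instance Definition _ := [Choice of BUC by <:].

Let bounded_segP f :
  bounded_fun f <-> exists M : R, forall t, `|f t| <= M.
Proof.
split=> [[M [_ fM]]|[M fM]].
  by exists (M + 1) => t; apply: fM => //; rewrite ltrDl.
exists M; split=> [|N MN t _ /=]; first exact: num_real.
by rewrite (le_trans (fM t))// ltW.
Qed.

Let BUC_submod_closed : submod_closed BUC_pred.
Proof.
split=> [|k f h].
  apply/asboolP; split; first by apply/bounded_segP; exists 0 => t; rewrite normr0.
  by move=> e e0; exists 1 => // s t _; rewrite subrr normr0.
move=> /asboolP[/bounded_segP[M fM] uf] /asboolP[/bounded_segP[N hN] uh].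
apply/asboolP; split.
  apply/bounded_segP; exists (`|k| * M + N) => t.
  by rewrite (le_trans (ler_normD _ _))// lerD// normrZ ler_wpM2l.
move=> e e0; have k1 : 0 < `|k| + 1 by rewrite ltr_wpDl.
have [d d0 fd] := uf (e / 2 / (`|k| + 1)) ltac:(by rewrite !divr_gt0).
have [d' d'0 hd'] := uh (e / 2) ltac:(by rewrite divr_gt0).
exists (Num.min d d'); first by rewrite lt_min d0.
move=> s t; rewrite lt_min => /andP[/fd fe /hd' he].
have -> : (k *: f + h) t - (k *: f + h) s = k *: (f t - f s) + (h t - h s).
  by rewrite scalerBr opprD addrACA.
rewrite (le_lt_trans (ler_normD _ _))// normrZ (splitr e) ler_ltD//.
apply: (@le_trans _ _ ((`|k| + 1) * `|f t - f s|)).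
  by rewrite ler_wpM2r// lerDl.
by rewrite mulrC -ler_pdivlMr// ltW.
Qed.

HB.instance Definition _ :=
  GRing.isSubmodClosed.Build R (segment a b -> V) BUC_pred
    (GRing.submod_closed_semi BUC_submod_closed).
HB.instance Definition _ := [SubChoice_isSubLmodule of BUC by <:].

Definition sup_norm (f : BUC) : R := sup (range (fun t => `|f t|)).

Let sup_norm_ub (f : BUC) t : `|f t| <= sup_norm f.
Proof.
apply: ub_le_sup; last by exists t.
have /asboolP[/bounded_segP[M fM] _] := valP f.
by exists M => _ [s _ <-]; exact: fM.
Qed.

Let sup_norm_le (f : BUC) M :
  0 <= M -> (forall t, `|f t| <= M) -> sup_norm f <= M.
Proof.
move=> M0 fM; rewrite /sup_norm.
have [[x0]|] := pselect (inhabited (segment a b)).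
  by apply: ge_sup => [|_ [t _ <-]//]; exists `|f x0|, x0.
move=> e; have -> : range (fun t => `|f t|) = set0; last by rewrite sup0.
by apply/seteqP; split=> // y [t _ _]; case: e.
Qed.

Let sup_norm_ge0 (f : BUC) : 0 <= sup_norm f.
Proof.
have [[x0]|e] := pselect (inhabited (segment a b)).
  exact: le_trans (sup_norm_ub f x0).
rewrite /sup_norm; have -> : range (fun t => `|f t|) = set0;
  last by rewrite sup0.
by apply/seteqP; split=> // y [t _ _]; case: e.
Qed.

Let sup_normD (f h : BUC) : sup_norm (f + h) <= sup_norm f + sup_norm h.
Proof.
apply: sup_norm_le => [|t]; first by rewrite addr_ge0.
by rewrite (le_trans (ler_normD _ _))// lerD.
Qed.

Let sup_normZ_le k (f : BUC) : sup_norm (k *: f) <= `|k| * sup_norm f.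
Proof.
apply: sup_norm_le => [|t]; first by rewrite mulr_ge0.
rewrite [(k *: f) t](_ : _ = k *: f t)//.
by rewrite normrZ ler_wpM2l.
Qed.

Let sup_normZ k (f : BUC) : sup_norm (k *: f) = `|k| * sup_norm f.
Proof.
apply/eqP; rewrite eq_le sup_normZ_le/=.
have [->|k0] := eqVneq k 0; first by rewrite normr0 mul0r.
rewrite -ler_pdivlMl ?normr_gt0// -normfV.
by rewrite -{1}[f](scalerK k0).
Qed.

Let sup_norm0_eq0 (f : BUC) : sup_norm f = 0 -> f = 0.
Proof.
move=> f0; apply/val_inj/funext => t; apply/eqP.
by rewrite -normr_le0 -f0.
Qed.

HB.instance Definition _ := Lmodule_isNormed.Build R BUC
  sup_normD sup_normZ sup_norm0_eq0.

End BUC.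

Arguments BUC_pred {R} V g a b.
Arguments BUC {R} V g a b.

(* A set of functions on the segment is dense in the space BUC when its
   elements belong to BUC and it is dense for the topology of [sup_norm]. *)
Definition dense_in_BUC (R : realType) (V : normedModType R) (g : R -> R)
    (a b : R) (S : set (segment a b -> V)) :=
  S `<=` [set f | f \in BUC_pred V g a b] /\
  dense [set f : BUC V g a b | S f].

(* Main.v *)
Require Import Defs.
From mathcomp Require Import all_boot all_order all_algebra.
From mathcomp Require Import all_classical all_reals all_analysis.
From mathcomp Require Import ring lra.
Import Order.TTheory GRing.Theory Num.Theory.
Import numFieldNormedType.Exports.
Local Open Scope classical_set_scope.
Local Open Scope ring_scope.

(* A uniformly g-continuous function factors through g, so the proof is
   Bernstein's approximation of a function of the single variable g(t), which is
   only known on the range of g. The values of the approximant at the equidistant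
   nodes x_k are taken at points t_k with g(t_k) close to x_k, when there are any;
   uniform continuity and boundedness then give, for all t,
     |v_k - f t| <= eps / 2 + K (x_k - g t)^2,
   and averaging over k turns the quadratic term into K times the variance of a
   binomial law, which is O(1 / n). The Bernstein polynomials are generated by the
   de Casteljau recursion, through which norm bounds, second moments and
   polynomiality are all immediate inductions. Real and complex coefficients are
   handled at once by approximants with coefficients in a normed module V. *)

(* [casteljau y n v] is the sum over [k <= n] of
   ['C(n, k) * y ^+ k * (1 - y) ^+ (n - k) *: v k]. *)
Fixpoint casteljau (R : pzRingType) (V : lmodType R) (y : R) (n : nat)
    (v : nat -> V) : V :=
  if n is m.+1 then
    (1 - y) *: casteljau R V y m v + y *: casteljau R V y m (v \o succn)
  else v 0%N.
Arguments casteljau {R V}.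

(** Second moment of a binomial law about [d]: variance plus squared bias. The centre [d] is
    arbitrary because shifting the nodes by [succn] replaces it by [d - 1] in the induction. *)
Lemma casteljau_sqr (R : comPzRingType) (y e C d : R) (n : nat) :
  casteljau (V := R^o) y n (fun k => e + C * (k%:R - d) ^+ 2) =
  e + C * (n%:R * y * (1 - y) + (n%:R * y - d) ^+ 2).
Proof.
elim: n d => [|n IHn] d /=; first by ring.
rewrite IHn (_ : _ \o _ = fun k => e + C * (k%:R - (d - 1)) ^+ 2); last first.
  by apply/funext => k /=; rewrite -natr1; ring.
by rewrite IHn /GRing.scale/= -natr1; ring.
Qed.

(** For [y] in the unit interval each step of the recursion is a convex combination, through which
    the triangle inequality passes. *)
Lemma ler_dist_casteljau (R : realType) (V : normedModType R) (y : R) (n : nat)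
    (l : V) (v : nat -> V) (u : nat -> R) :
  0 <= y <= 1 -> (forall k, `|v k - l| <= u k) ->
  `|casteljau y n v - l| <= casteljau (V := R^o) y n u.
Proof.
move=> /andP[y0 y1]; elim: n v u => [|n IHn] v u vu /=; first exact: vu.
have -> : (1 - y) *: casteljau y n v + y *: casteljau y n (v \o succn) - l =
  (1 - y) *: (casteljau y n v - l) + y *: (casteljau y n (v \o succn) - l).
  by rewrite !scalerBr addrACA -opprD -scalerDl subrK scale1r.
rewrite (le_trans (ler_normD _ _))// !normrZ !ger0_norm ?subr_ge0//.
by rewrite lerD// ler_wpM2l ?subr_ge0 ?IHn// => k; exact: vu.
Qed.

Lemma casteljau_sum (R : comPzRingType) (V : lmodType R) (p q : R) (n : nat)
    (v : nat -> V) :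
  exists c : nat -> V, forall x,
    casteljau (p * x + q) n v = \sum_(k < n.+1) x ^+ k *: c k.
Proof.
elim: n v => [|n IHn] v.
  by exists v => x; rewrite big_ord1 expr0 scale1r.
have [c cE] := IHn v; have [d dE] := IHn (v \o succn).
(* [lo] collects the terms whose degree in [x] is kept, [hi] those raised by the factor [p * x]; the
   cutoff discards the meaningless coefficients of index [n.+1]. *)
pose lo k := if (k <= n)%N then (1 - q) *: c k + q *: d k else 0.
pose hi k := if k is j.+1 then p *: (d j - c j) else 0.
exists (fun k => lo k + hi k) => x /=; rewrite cE dE.
under [RHS]eq_bigr do rewrite scalerDr.
rewrite big_split/= [X in _ = X + _]big_ord_recr/= [X in _ = _ + X]big_ord_recl/=.
rewrite /lo ltnn !scaler0 addr0 add0r !scaler_sumr -!big_split/=.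
apply: eq_bigr => k _; rewrite -ltnS ltn_ord /bump/= add1n exprS.
rewrite scalerBr !scalerDr scalerN !scalerA.
have -> : (1 - (p * x + q)) * x ^+ k = x ^+ k * (1 - q) - x * x ^+ k * p by ring.
have -> : (p * x + q) * x ^+ k = x ^+ k * q + x * x ^+ k * p by ring.
by rewrite scalerBl scalerDl addrACA [- _ + _]addrC.
Qed.

Lemma weierstrass_along (R : realType) (V : normedModType R) (T : Type)
    (c w : R) (gT : T -> R) (f : T -> V) (M : R) :
  0 < w -> (forall t, c <= gT t <= c + w) -> (forall t, `|f t| <= M) ->
  (forall eps : R, 0 < eps -> exists2 delta : R, 0 < delta &
    forall s t, `|gT t - gT s| < delta -> `|f t - f s| < eps) ->
  forall eps : R, 0 < eps -> exists (n : nat) (a : 'I_n.+1 -> V), forall t,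
    `|\sum_(k < n.+1) gT t ^+ k *: a k - f t| <= eps.
Proof.
move=> w0 gcw fM fuc eps eps0.
have w_neq0 : w != 0 by rewrite gt_eqF.
have [delta delta0 fdelta] := fuc (eps / 2) ltac:(by rewrite divr_gt0).
have [[t0]|noT] := pselect (inhabited T); last first.
  by exists 0%N, (fun=> 0) => t; case: noT.
have M0 : 0 <= M := le_trans (normr_ge0 _) (fM t0).
(* At distance [delta / 2] the quadratic term reaches [2 * M], which bounds any difference of values
   of [f]. *)
pose K := 2 * M / (delta / 2) ^+ 2.
have K0 : 0 <= K by rewrite /K divr_ge0 ?sqr_ge0// mulr_ge0.
(* Chosen so that [K * w ^+ 2 / n] is below [eps / 2]. *)
pose n := (Num.trunc (2 * K * w ^+ 2 / eps)).+1.
have n0 : 0 < n%:R :> R by rewrite ltr0n.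
have n_neq0 : n%:R != 0 :> R by rewrite gt_eqF.
have nK : 2 * K * w ^+ 2 / eps < n%:R by rewrite truncnS_gt.
pose node (k : nat) : R := c + w * k%:R / n%:R.
(* [v k] is a value of [f] at a point whose image is near the k-th node, if
   there is one; otherwise the quadratic term alone absorbs the error. *)
pose v k := if pselect (exists t, `|node k - gT t| < delta / 2) is left e
            then f (projT1 (cid e)) else 0.
have vP k t : `|v k - f t| <= eps / 2 + K * (node k - gT t) ^+ 2.
  have [near|far] := ltP `|node k - gT t| (delta / 2).
    rewrite /v; case: pselect => [e|]; last by case; exists t.
    case: cid => s /= near_s.
    apply: ler_wpDr; first by rewrite mulr_ge0 ?sqr_ge0.
    apply/ltW/fdelta.
    have -> : gT s - gT t = (node k - gT t) - (node k - gT s) by ring.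
    by rewrite (splitr delta) (le_lt_trans (ler_normB _ _))// ltrD.
  rewrite ler_wpDl ?divr_ge0 ?(ltW eps0)//.
  apply: (@le_trans _ _ (2 * M)).
    rewrite (le_trans (ler_normB _ _))// mulr_natl mulr2n lerD//.
    by rewrite /v; case: pselect => [e|_]; rewrite ?normr0.
  rewrite /K mulrAC ler_pdivlMr ?exprn_gt0 ?divr_gt0//.
  rewrite ler_wpM2l ?mulr_ge0// -[leRHS]real_normK ?num_real//.
  by rewrite lerXn2r ?nnegrE ?divr_ge0 ?(ltW delta0).
have [a aE] := casteljau_sum R V w^-1 (- c / w) n v.
exists n, (fun k => a k) => t; rewrite -aE.
set y := w^-1 * gT t + - c / w.
have gE : gT t = c + w * y by rewrite /y; field.
have /andP[y0 y1] : 0 <= y <= 1.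
  move: (gcw t); rewrite gE lerDl lerD2l => /andP[].
  by rewrite pmulr_rge0// -{2}[w]mulr1 ler_pM2l// => -> ->.
(* The bound of [vP] in terms of [y], centred at the mean [n * y] so that only the variance
   remains. *)
pose u (k : nat) := eps / 2 + K * (w / n%:R) ^+ 2 * (k%:R - n%:R * y) ^+ 2.
apply: (@le_trans _ _ (casteljau (V := R^o) y n u)).
  apply: ler_dist_casteljau; first by rewrite y0.
  move=> k; rewrite (le_trans (vP k t))// /u /node gE.
  by rewrite le_eqVlt; apply/orP; left; apply/eqP; field.
rewrite casteljau_sqr subrr expr0n addr0 {2}(splitr eps) lerD2l.
have -> : K * (w / n%:R) ^+ 2 * (n%:R * y * (1 - y)) =
   K * w ^+ 2 * (y * (1 - y)) / n%:R by field.
rewrite ler_pdivrMr//.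
apply: (@le_trans _ _ (K * w ^+ 2)).
  by rewrite ler_piMr ?mulr_ge0 ?sqr_ge0//; nra.
move: nK; rewrite ltr_pdivrMr//; lra.
Qed.

(** Only real powers of [g] act on the coefficients, so a real module structure on [V] suffices and
    covers both fields. *)
Definition vector_g_polynomials (R : realType) (V : lmodType R) (g : R -> R) :
    set (R -> V) :=
  [set h | exists (n : nat) (c : 'I_n.+1 -> V),
    h = fun t => \sum_(k < n.+1) g t ^+ k *: c k].

Section BUC_theory.
Context (R : realType) (V : normedModType R) (g : R -> R) (a b : R).

Lemma BUC_predP (f : segment a b -> V) :
  f \in BUC_pred V g a b <->
  (exists M, forall t, `|f t| <= M) /\ uniformly_g_continuous g f.
Proof.
split=> [/asboolP[[M [_ fM]] uf]|[[M fM] uf]].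
  by split=> //; exists (M + 1) => t; apply: fM => //; rewrite ltrDl.
apply/asboolP; split=> //; exists M; split=> [|N MN t _ /=].
  exact: num_real.
exact: le_trans (fM t) (ltW MN).
Qed.

Lemma norm_BUC_le (f : BUC V g a b) (M : R) :
  0 <= M -> (forall t, `|f t| <= M) -> `|f| <= M.
Proof.
move=> M0 fM; change (sup (range (fun t => `|f t|)) <= M).
have [->|ne] := eqVneq (range (fun t => `|f t|)) set0; first by rewrite sup0.
by apply: ge_sup => [|_ [t _ <-]//]; exact/set0P.
Qed.

Hypothesis g_nondecr : {homo g : x y / x <= y}.

(** By monotonicity [g] is bounded on the segment, so the usual estimate for a product of bounded
    uniformly continuous functions applies. *)
Lemma BUC_scale_g (f : segment a b -> V) :
  f \in BUC_pred V g a b -> (fun t => g (val t) *: f t) \in BUC_pred V g a b.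
Proof.
move=> /BUC_predP[[M fM] uf]; pose G := `|g a| + `|g b| + 1.
have gG t : `|g (val (t : segment a b))| <= G.
  have /andP[/g_nondecr ga /g_nondecr gb] : a <= val t <= b by exact: (valP t).
  rewrite /G ler_norml; have := ler_norm (g b).
  have := ler_norm (- g a); rewrite normrN.
  by have := normr_ge0 (g a); have := normr_ge0 (g b); lra.
have G0 : 0 < G by rewrite /G ltr_wpDl ?addr_ge0.
apply/BUC_predP; split.
  by exists (G * M) => t; rewrite normrZ ler_pM.
move=> e e0; pose N := `|M| + 1.
have N0 : 0 < N by rewrite ltr_wpDl.
have fN t : `|f t| <= N.
  by rewrite (le_trans (fM t))// (le_trans (ler_norm M))// lerDl.
have [d d0 fd] := uf (e / 2 / G) ltac:(by rewrite !divr_gt0).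
exists (Num.min d (e / 2 / N)); first by rewrite lt_min d0 !divr_gt0.
move=> s t; rewrite lt_min => /andP[/fd fe ge].
have -> : g (val t) *: f t - g (val s) *: f s =
  g (val t) *: (f t - f s) + (g (val t) - g (val s)) *: f s.
  by rewrite scalerBr scalerBl addrA subrK.
rewrite (le_lt_trans (ler_normD _ _))// !normrZ (splitr e) ltr_leD//.
  apply: (@le_lt_trans _ _ (G * `|f t - f s|)); first by rewrite ler_wpM2r.
  by rewrite mulrC -ltr_pdivlMr.
apply: (@le_trans _ _ (`|g (val t) - g (val s)| * N)); first by rewrite ler_wpM2l.
by rewrite -ler_pdivlMr// ltW.
Qed.

Lemma BUC_vector_g_polynomials (h : R -> V) :
  vector_g_polynomials R V g h -> restrict_segment a b h \in BUC_pred V g a b.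
Proof.
move=> [n [c ->]].
have -> : restrict_segment a b (fun t => \sum_(k < n.+1) g t ^+ k *: c k) =
  \sum_(k < n.+1) (fun t : segment a b => g (val t) ^+ k *: c k).
  by apply/funext => t; rewrite fct_sumE.
apply: rpred_sum => k _; elim: (k : nat) => [|j IHj].
  apply/BUC_predP; split; first by exists `|c k| => t; rewrite expr0 scale1r.
  by move=> e e0; exists 1 => // s t _; rewrite !expr0 subrr normr0.
under eq_fun do rewrite exprS -scalerA.
exact: BUC_scale_g.
Qed.

Lemma dense_vector_g_polynomials :
  dense_in_BUC g
    [set restrict_segment a b h | h in vector_g_polynomials R V g].
Proof.
split=> [_ [h hg <-]|O [f Of] Oopen]; first exact: BUC_vector_g_polynomials.
have /nbhs_ballP[e /= e0 eO] := open_nbhs_nbhs (conj Oopen Of).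
have [[M fM] uf] := (BUC_predP f).1 (valP f).
(* The added 1 keeps the width positive even when [g a = g b]. *)
have gab t : g a <= g (val (t : segment a b)) <= g a + (`|g b - g a| + 1).
  have /andP[/g_nondecr -> /g_nondecr gb] : a <= val t <= b by exact: (valP t).
  by have := ler_norm (g b - g a); lra.
(* Half the radius, since pointwise bounds only give a non-strict bound on the supremum. *)
have [n [c cf]] := weierstrass_along R V _ (g a) (`|g b - g a| + 1)
  (fun t : segment a b => g (val t)) f M ltac:(by rewrite ltr_wpDl) gab fM uf
  (e / 2) ltac:(by rewrite divr_gt0).
pose h t := \sum_(k < n.+1) g t ^+ k *: c k.
have hg : vector_g_polynomials R V g h by exists n, c.
have hBUC := BUC_vector_g_polynomials h hg.
exists (Sub (restrict_segment a b h) hBUC); split; last by exists h.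
apply: eO; rewrite -ball_normE/= distrC (@le_lt_trans _ _ (e / 2))//.
  by apply: norm_BUC_le => [|t]; [rewrite divr_ge0 ?ltW|exact: cf].
by rewrite ltr_pdivrMr// ltr_pMr// ltr1n.
Qed.

End BUC_theory.

(** Lets a complex polynomial in [g] be read as one with vector coefficients over the reals. *)
Lemma mulr_real_complex (R : realType) (r : R) (z : Rcomplex R) :
  z * real_complex R r = r *: z.
Proof.
rewrite mulrC; case: z => x y; rewrite /GRing.mul/= /GRing.scale/=.
by congr (_ +i* _)%C; rewrite mul0r ?subr0 ?addr0.
Qed.

Theorem theorem3p17 (R : realType) (a b : R) (hab : a < b) (g : R -> R)
    (g_nondecr : {homo g : x y / x <= y}) (g_leftcont : left_continuous g) :
  dense_in_BUC g
    [set restrict_segment a b h | h in g_polynomials (fun x : R => x : R^o) g] /\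
  dense_in_BUC g
    [set restrict_segment a b h |
       h in g_polynomials (fun x : R => real_complex R x : Rcomplex R) g].
Proof.
split.
  have -> : g_polynomials (fun x : R => x : R^o) g = vector_g_polynomials R R^o g.
    apply/seteqP; split=> _ [n [c ->]]; exists n, c; apply/funext => t;
      by apply: eq_bigr => k _; rewrite /GRing.scale/= mulrC.
  exact: dense_vector_g_polynomials.
have -> : g_polynomials (fun x : R => real_complex R x : Rcomplex R) g =
    vector_g_polynomials R (Rcomplex R) g.
  apply/seteqP; split=> _ [n [c ->]]; exists n, c; apply/funext => t;
    by apply: eq_bigr => k _; rewrite -mulr_real_complex rmorphXn.
exact: dense_vector_g_polynomials.
Qed.
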